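(* Let $E_1,\ldots,E_m$ be (real) Banach lattices whose duals have the positive Schur property and let $F$ be a Banach lattice with order continuous norm. If a positive $m$-linear operator $A\colon E_1\times\cdots\times E_m\longrightarrow F$ admits a positive genuine separately weak$^*$-weak$^*$ continuous bidual extension $\widetilde{A}\colon E_1^{**}\times\cdots\times E_m^{**}\longrightarrow F^{**}$, then $\widetilde{A}$ is separately almost Dunford-Pettis. In particular, $A$ is separately almost Dunford-Pettis.
   Context: $J_G\colon G\to G^{**}$ is the canonical embedding. A sequence $(x_n)$ in a Banach lattice is disjoint if $|x_n|\wedge|x_k|=0$ for $n\ne k$. A Banach lattice $E$ has the positive Schur property if positive weakly null sequences in $E$ are norm null (equivalently, disjoint weakly null sequences, or disjoint positive weakly null sequences, are norm null). An $m$-linear operator between Banach lattices is positive if it maps tuples of positive elements to positive elements. A bounded linear operator from a Banach lattice $E$ to a Banach space $G$ is almost Dunford-Pettis if it sends disjoint weakly null sequences in $E$ to norm null sequences in $G$. An $m$-linear operator $A\colon E_1\times\cdots\times E_m\to G$ ($E_i$ Banach lattices, $G$ Banach space) is separately almost Dunford-Pettis if for each $j$ and all fixed $x_i\in E_i$, $i\ne j$, the linear operator $x_j\in E_j\mapsto A(x_1,\ldots,x_m)\in G$ is almost Dunford-Pettis. A bidual extension of a continuous $m$-linear operator $A\colon G_1\times\cdots\times G_m\to G$ between Banach spaces is a continuous $m$-linear operator $\widetilde A\colon G_1^{**}\times\cdots\times G_m^{**}\to G^{**}$ with $\widetilde A(J_{G_1}(x_1),\ldots,J_{G_m}(x_m))=J_G(A(x_1,\ldots,x_m))$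 for all $x_i\in G_i$. It is genuine if its range is contained in $J_G(G)$. It is separately weak$^*$-weak$^*$ continuous if, for each $j$ and all fixed elements of the other biduals $G_i^{**}$, $i\neq j$, the map $x_j^{**}\mapsto\widetilde A(x_1^{**},\ldots,x_m^{**})$ is continuous from $(G_j^{**},\sigma(G_j^{**},G_j^* ))$ to $(G^{**},\sigma(G^{**},G^* ))$. *)

(* Defs.v *)
From HB Require Import structures.
From mathcomp Require Import all_boot all_order all_algebra.
From mathcomp Require Import all_classical all_reals topology normedtype.
From mathcomp Require Import ring lra.
Set Implicit Arguments.
Unset Strict Implicit.
Unset Printing Implicit Defensive.
Import Order.TTheory GRing.Theory Num.Theory.
Import numFieldNormedType.Exports.
Local Open Scope classical_set_scope.
Local Open Scope ring_scope.

Definition continuous_functional (R : realType) (G : normedModType R) :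
    {pred (G -> R)} :=
  [pred f : G -> R | `[< linear f /\ continuous f >] ].

Fact continuous_functional_submod (R : realType) (G : normedModType R) :
  submod_closed (@continuous_functional R G : {pred (G -> R)}).
Proof.
split.
  apply/asboolP; split.
    by move=> a x y /=; rewrite scaler0 addr0.
  by move=> x; exact: cvg_cst.
move=> a f g /asboolP[lf cf] /asboolP[lg cg]; apply/asboolP; split.
  move=> b x y /=; rewrite !fctE/= lf lg /GRing.scale/=; ring.
move=> x; apply: (@continuousD R R^o G (fun x => a *: f x) g x).
  by apply: (@continuousZr R R^o G f a x); exact: cf.
exact: cg.
Qed.

HB.instance Definition _ (R : realType) (G : normedModType R) :=
  GRing.isSubmodClosed.Build R (G -> R) (@continuous_functional R G)
    (continuous_functional_submod G).

Record topdual (R : realType) (G : normedModType R) := TopDual {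
  topdual_fun :> G -> R;
  topdualP : topdual_fun \in @continuous_functional R G }.

HB.instance Definition _ (R : realType) (G : normedModType R) :=
  [isSub for @topdual_fun R G].
HB.instance Definition _ (R : realType) (G : normedModType R) :=
  [Choice of topdual G by <:].
HB.instance Definition _ (R : realType) (G : normedModType R) :=
  [SubChoice_isSubLmodule of topdual G by <:].

Section topdual_theory.
Variables (R : realType) (G : normedModType R).
Implicit Types (f g : topdual G) (x y : G).

Lemma topdual_linear f : linear f.
Proof. by have /asboolP[] := topdualP f. Qed.

Lemma topdual_continuous f : continuous f.
Proof. by have /asboolP[] := topdualP f. Qed.

HB.instance Definition _ f :=
  GRing.isLinear.Build R G R _ f (@topdual_linear f).

Lemma topdual_ext f g : (forall x, f x = g x) -> f = g.
Proof. by move=> fg; apply/val_inj/funext. Qed.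

Lemma topdual0E x : (0 : topdual G) x = 0. Proof. by []. Qed.

Lemma topdualDE f g x : (f + g) x = f x + g x. Proof. by []. Qed.

Lemma topdualNE f x : (- f) x = - f x. Proof. by []. Qed.

Lemma topdualZE (a : R) f x : (a *: f) x = a * f x. Proof. by []. Qed.

Lemma bounded_continuous_functional (f : G -> R) (C : R) :
  linear f -> (forall x, `|f x| <= C * `|x|) -> f \in @continuous_functional R G.
Proof.
move=> lf fC; apply/asboolP; split=> //.
pose fl : {linear G -> R} := HB.pack f (GRing.isLinear.Build R G R _ f lf).
apply: (@bounded_linear_continuous R G R^o fl).
apply/linear_boundedP; near=> r => x; apply: (le_trans (fC x)).
by apply: ler_wpM2r => //; near: r; apply: nbhs_pinfty_ge; exact: num_real.
Unshelve. all: by end_near. Qed.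

Definition topdual_norm f : R := sup [set `|f x| | x in [set x | `|x| <= 1]].

Let topdual_norm_has_sup f : has_sup [set `|f x| | x in [set x | `|x| <= 1]].
Proof.
split; first by exists `|f 0|, 0 => //=; rewrite normr0.
have /linear_bounded_continuous/linear_boundedP := @topdual_continuous f.
move=> /pinfty_ex_gt0[M M0 fM]; exists M => _ [x /= x1 <-].
by rewrite (le_trans (fM x))// ler_piMr// ltW.
Qed.

Lemma topdual_norm_le f (C : R) : 0 <= C ->
  (forall x, `|f x| <= C * `|x|) -> topdual_norm f <= C.
Proof.
move=> C0 fC; apply: ge_sup; first by case: (topdual_norm_has_sup f).
by move=> _ [x /= x1 <-]; rewrite (le_trans (fC x))// ler_piMr.
Qed.

Lemma topdual_norm_ge0 f : 0 <= topdual_norm f.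
Proof.
apply: (@le_trans _ _ `|f 0|) => //; apply: ub_le_sup.
  by case: (topdual_norm_has_sup f).
by exists 0 => //=; rewrite normr0.
Qed.

Lemma topdual_norm_ub f x : `|f x| <= topdual_norm f * `|x|.
Proof.
have [->|x0] := eqVneq x 0; first by rewrite linear0 !normr0 mulr0.
rewrite -ler_pdivrMr ?normr_gt0//.
have -> : `|f x| / `|x| = `|f (`|x|^-1 *: x)|.
  by rewrite linearZ normrM normfV normr_id mulrC.
apply: ub_le_sup; first by case: (topdual_norm_has_sup f).
by exists (`|x|^-1 *: x) => //=; rewrite normrZ normfV normr_id mulVf ?normr_eq0.
Qed.

Fact topdual_normD f g : topdual_norm (f + g) <= topdual_norm f + topdual_norm g.
Proof.
apply: topdual_norm_le => [|x]; first by rewrite addr_ge0// topdual_norm_ge0.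
by rewrite mulrDl (le_trans (ler_normD _ _))// lerD// topdual_norm_ub.
Qed.

Fact topdual_normZ (a : R) f : topdual_norm (a *: f) = `|a| * topdual_norm f.
Proof.
have le_normZ (b : R) g : topdual_norm (b *: g) <= `|b| * topdual_norm g.
  apply: topdual_norm_le => [|x]; first by rewrite mulr_ge0// topdual_norm_ge0.
  by rewrite topdualZE normrM -mulrA ler_wpM2l// topdual_norm_ub.
apply/eqP; rewrite eq_le le_normZ/=.
have [->|a0] := eqVneq a 0; first by rewrite normr0 mul0r topdual_norm_ge0.
rewrite -ler_pdivlMl ?normr_gt0// -normfV.
by have := le_normZ a^-1 (a *: f); rewrite scalerA mulVf// scale1r.
Qed.

Fact topdual_norm_eq0 f : topdual_norm f = 0 -> f = 0.
Proof.
move=> f0; apply: topdual_ext => x; apply/eqP.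
by have := topdual_norm_ub f x; rewrite f0 mul0r normr_le0.
Qed.

HB.instance Definition _ := Lmodule_isNormed.Build R (topdual G)
  topdual_normD topdual_normZ topdual_norm_eq0.

Lemma topdual_normE f : `|f| = topdual_norm f. Proof. by []. Qed.

Fact topdual_complete (F : set_system (topdual G)) :
  ProperFilter F -> cauchy F -> cvg F.
Proof.
move=> FF Fc.
have Fball (e : R) : 0 < e -> exists f, F (ball f e).
  by move=> e0; have /cauchyP := Fc; exact.
have ballE f g e x : ball f e g -> `|f x - g x| <= e * `|x|.
  rewrite -ball_normE/= => fg; apply: (le_trans (topdual_norm_ub (f - g) x)).
  by rewrite ler_wpM2r// ltW.
have cvgx x : cvg ((fun f : topdual G => f x) @ F).
  apply: R_complete; apply/cauchy_exP => e e0.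
  have d0 : 0 < e / (`|x| + 1) by rewrite divr_gt0// ltr_wpDl.
  have [f Ff] := Fball _ d0.
  exists (f x); rewrite nbhs_simpl/=; apply: filterS Ff => g /(ballE _ _ _ x) fg.
  rewrite /= -ball_normE/=; apply: (le_lt_trans fg).
  by rewrite mulrAC ltr_pdivrMr ?ltr_wpDl// ltr_pM2l// ltrDl.
pose l x : R := lim ((fun f : topdual G => f x) @ F).
have cvgl x : (fun f : topdual G => f x : R) @ F --> l x by exact: cvgx.
have ll : linear l.
  move=> a x y; rewrite {1}/l.
  have -> : (fun f : topdual G => f (a *: x + y)) =
      (fun f : topdual G => a *: (f x : R^o) + f y).
    by apply/funext => f; rewrite linearP.
  apply: (@cvg_lim R^o) => //; apply: (@cvgD R R^o) => //.
  by apply: (@cvgZr R R^o).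
have lball f e x : F (ball f e) -> `|f x - l x| <= e * `|x|.
  move=> Ff; have cl : (fun g : topdual G => `|f x - g x|) @ F --> `|f x - l x|.
    apply: (@cvg_norm R R^o); apply: (@cvgB R R^o); first exact: cvg_cst.
    exact: cvgl.
  apply: (closed_cvg [set z : R | z <= e * `|x|] _ _ _ cl).
    exact: closed_le.
  by apply: filterS Ff => g /(ballE _ _ _ x); exact.
have [f0 Ff0] := Fball _ ltr01.
have lP : l \in @continuous_functional R G.
  apply: (@bounded_continuous_functional _ (1 + topdual_norm f0)) => // x.
  have := lball _ _ x Ff0; have := topdual_norm_ub f0 x.
  have := ler_normB (f0 x) (f0 x - l x); rewrite subKr mulrDl; lra.
apply/cvg_ex; exists (TopDual lP); apply/(@cvgrPdist_le _ _ _ F) => e e0.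
have e20 : 0 < e / 2 by rewrite divr_gt0.
have [f Ff] := Fball _ e20; near=> g.
apply: topdual_norm_le => [|x]; first exact: ltW.
have /(ballE _ _ _ x) : ball f (e / 2) g by near: g.
have := lball _ _ x Ff; have := ler_normB (f x - g x) (f x - l x).
rewrite [X in `|X| <= _ + _ -> _](_ : _ = l x - g x); last by ring.
rewrite /= !fctE/=; lra.
Unshelve. all: by end_near. Qed.

HB.instance Definition _ := Uniform_isComplete.Build (topdual G) topdual_complete.

End topdual_theory.

Reserved Notation "x '<=v' y" (at level 70, y at next level).

(* The order carries its own operations because Hierarchy Builder admits no
   structure joining Order.Lattice with normed modules: the required common
   ancestors with Num.NumDomain and Num.RealDomain are missing. *)
HB.mixin Record CompleteNormedModule_isBanachLattice (R : realType) E
    of CompleteNormedModule R E := {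
  vle : rel E;
  vmeet : E -> E -> E;
  vjoin : E -> E -> E;
  vlexx : reflexive vle;
  vle_anti : antisymmetric vle;
  vle_trans : transitive vle;
  vlexI : forall x y z, vle x (vmeet y z) = vle x y && vle x z;
  vleUx : forall x y z, vle (vjoin x y) z = vle x z && vle y z;
  vleD2r : forall z x y, vle x y -> vle (x + z) (y + z);
  vscale_ge0 : forall (a : R) x, 0 <= a -> vle 0 x -> vle 0 (a *: x);
  vnorm_abs : forall x y, vle (vjoin x (- x)) (vjoin y (- y)) -> `|x| <= `|y| }.

#[short(type="banachLatticeType")]
HB.structure Definition BanachLattice (R : realType) :=
  {E of CompleteNormedModule R E & CompleteNormedModule_isBanachLattice R E}.

Notation "x '<=v' y" := (vle x y) : ring_scope.

Definition vabs (R : realType) (E : banachLatticeType R) (x : E) : E :=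
  vjoin x (- x).

Section banach_lattice_theory.
Variables (R : realType) (E : banachLatticeType R).
Implicit Types (x y z t : E) (a : R).

Lemma vle_tr y x z : x <=v y -> y <=v z -> x <=v z.
Proof. exact: vle_trans. Qed.

Lemma vleUl x y : x <=v vjoin x y.
Proof. by have := vlexx (vjoin x y); rewrite vleUx => /andP[]. Qed.

Lemma vleUr x y : y <=v vjoin x y.
Proof. by have := vlexx (vjoin x y); rewrite vleUx => /andP[]. Qed.

Lemma vleIl x y : vmeet x y <=v x.
Proof. by have := vlexx (vmeet x y); rewrite vlexI => /andP[]. Qed.

Lemma vleIr x y : vmeet x y <=v y.
Proof. by have := vlexx (vmeet x y); rewrite vlexI => /andP[]. Qed.

Lemma vleD2rE z x y : (x + z <=v y + z) = (x <=v y).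
Proof.
apply/idP/idP; last exact: vleD2r.
by move=> /(vleD2r (- z)); rewrite !addrK.
Qed.

Lemma vsubr_ge0 x y : (0 <=v y - x) = (x <=v y).
Proof. by rewrite -(vleD2rE x) add0r subrK. Qed.

Lemma vleBlDr x y z : (x - y <=v z) = (x <=v z + y).
Proof. by rewrite -(vleD2rE y) subrK. Qed.

Lemma vleBrDr x y z : (x <=v y - z) = (x + z <=v y).
Proof. by rewrite -(vleD2rE z) subrK. Qed.

Lemma vleN2 x y : (- x <=v - y) = (y <=v x).
Proof. by rewrite -vsubr_ge0 opprK addrC vsubr_ge0. Qed.

Lemma vleD x y z t : x <=v y -> z <=v t -> x + z <=v y + t.
Proof.
move=> xy zt; apply: (@vle_tr (y + z)); first exact: vleD2r.
by rewrite ![y + _]addrC vleD2rE.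
Qed.

Lemma vaddr_ge0 x y : 0 <=v x -> 0 <=v y -> 0 <=v x + y.
Proof. by move=> x0 y0; rewrite -[0]addr0 vleD. Qed.

Lemma vleZ2l a x y : 0 <= a -> x <=v y -> a *: x <=v a *: y.
Proof.
by move=> a0 xy; rewrite -vsubr_ge0 -scalerBr vscale_ge0// vsubr_ge0.
Qed.

Lemma vleZ2lE a x y : 0 < a -> (a *: x <=v a *: y) = (x <=v y).
Proof.
move=> a0; apply/idP/idP => [axy|]; last by apply: vleZ2l; exact: ltW.
rewrite -[x](scalerK (lt0r_neq0 a0)) -[y](scalerK (lt0r_neq0 a0)).
by apply: vleZ2l axy; rewrite invr_ge0 ltW.
Qed.

Lemma vjoinDr x y z : vjoin x y + z = vjoin (x + z) (y + z).
Proof.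
apply/vle_anti/andP; split; last by rewrite vleUx !vleD2rE vleUl vleUr.
by rewrite -vleBrDr vleUx !vleBrDr vleUl vleUr.
Qed.

Lemma vjoinC x y : vjoin x y = vjoin y x.
Proof. by apply/vle_anti; rewrite !vleUx !vleUl !vleUr. Qed.

Lemma vjoin_l x y : y <=v x -> vjoin x y = x.
Proof. by move=> yx; apply/vle_anti; rewrite vleUl vleUx vlexx yx. Qed.

Definition vpos x : E := vjoin x 0.

Lemma vpos_ge0 x : 0 <=v vpos x. Proof. exact: vleUr. Qed.

Lemma vpos_sub x : vpos x - vpos (- x) = x.
Proof.
apply/eqP; rewrite subr_eq addrC [eqbRHS]vjoinDr addNr add0r.
by rewrite vjoinC.
Qed.

Lemma vpos_id x : 0 <=v x -> vpos x = x.
Proof. exact: vjoin_l. Qed.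

Lemma vpos_le_abs x : vpos x <=v vabs x.
Proof.
rewrite vleUx vleUl/=.
rewrite -(@vleZ2lE 2)// scaler0 scaler_nat mulr2n.
by rewrite -(subrr x) vleD ?vleUl ?vleUr.
Qed.

Lemma vabs_ge0 x : 0 <=v vabs x.
Proof. exact: vle_tr (vpos_ge0 x) (vpos_le_abs x). Qed.

Lemma vabs_id x : 0 <=v x -> vabs x = x.
Proof.
move=> x0; apply: vjoin_l; apply: (@vle_tr 0) => //.
by rewrite -oppr0 vleN2.
Qed.

Lemma vnorm_le x y : 0 <=v x -> x <=v y -> `|x| <= `|y|.
Proof.
move=> x0 xy; apply: vnorm_abs; rewrite -/(vabs x) -/(vabs y) !vabs_id//.
exact: (vle_tr x0 xy).
Qed.

Lemma vnorm_vabs x : `|vabs x| = `|x|.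
Proof.
by apply/le_anti/andP; split; apply: vnorm_abs;
  rewrite -!/(vabs _) [vabs (vabs _)]vabs_id ?vabs_ge0 ?vlexx.
Qed.

Lemma vnorm_pos x : `|vpos x| <= `|x|.
Proof. by rewrite -(vnorm_vabs x) vnorm_le// ?vpos_ge0 ?vpos_le_abs. Qed.

Lemma vabsE x : vabs x = vpos x + vpos (- x).
Proof.
have -> : vpos (- x) = vpos x - x by rewrite -{3}(vpos_sub x) subKr.
have two0 : 2 != 0 :> R by rewrite pnatr_eq0.
have double : vpos x + vpos x = vjoin (x + x) 0.
  apply/vle_anti/andP; split; last first.
    by rewrite vleUx vleD ?vleUl//= vaddr_ge0 ?vpos_ge0.
  rewrite -[vpos x + _]mulr2n -scaler_nat.
  rewrite -[vjoin (x + x) 0](scalerKV two0).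
  rewrite vleZ2lE// vleUx -(@vleZ2lE 2 x)// scalerKV//.
  by rewrite scaler_nat mulr2n vleUl/= vscale_ge0 ?invr_ge0 ?vleUr.
by rewrite addrA double vjoinDr addrK sub0r.
Qed.

Lemma riesz_decomposition x y z : 0 <=v x -> 0 <=v y -> 0 <=v z ->
  z <=v x + y -> exists z1 z2,
    [/\ z = z1 + z2, 0 <=v z1, z1 <=v x, 0 <=v z2 & z2 <=v y].
Proof.
move=> x0 y0 z0 zxy; exists (vmeet z x), (z - vmeet z x); split.
- by rewrite addrC subrK.
- by rewrite vlexI z0.
- exact: vleIr.
- by rewrite vsubr_ge0 vleIl.
- by rewrite vleBlDr addrC -vleBlDr vlexI !vleBlDr zxy andbT
    -vsubr_ge0 addrAC subrr add0r.
Qed.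

Section cone_extension.
Variables (q : E -> R) (C : R).
Hypothesis qD : forall x y, 0 <=v x -> 0 <=v y -> q (x + y) = q x + q y.
Hypothesis qZ : forall a x, 0 <= a -> 0 <=v x -> q (a *: x) = a * q x.
Hypothesis qC : forall x, 0 <=v x -> `|q x| <= C * `|x|.

Let l x : R := q (vpos x) - q (vpos (- x)).

Let l_sub x y : 0 <=v x -> 0 <=v y -> l (x - y) = q x - q y.
Proof.
move=> x0 y0; apply/eqP; rewrite subr_eq addrAC eq_sym subr_eq eq_sym.
rewrite -!qD ?vpos_ge0//; apply/eqP; congr q.
have /eqP := vpos_sub (x - y).
by rewrite subr_eq addrAC => /eqP {1}->; rewrite subrK.
Qed.

Let l_linear : linear l.
Proof.
have lD x y : l (x + y) = l x + l y.
  rewrite -{1}(vpos_sub x) -{1}(vpos_sub y) addrACA -opprD.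
  by rewrite l_sub ?vaddr_ge0 ?vpos_ge0// !qD ?vpos_ge0// opprD addrACA.
have lN x : l (- x) = - l x by rewrite /l opprK opprB.
have lZ a x : 0 <= a -> l (a *: x) = a * l x.
  move=> a0; rewrite -{1}(vpos_sub x) scalerBr l_sub ?vscale_ge0 ?vpos_ge0//.
  by rewrite !qZ ?vpos_ge0// mulrBr.
move=> a x y; rewrite lD; congr (_ + _).
have [a0|a0] := leP 0 a; first exact: lZ.
rewrite -[a in LHS]opprK scaleNr lN lZ ?oppr_ge0 ?ltW//.
by rewrite mulNr opprK.
Qed.

Let l_bounded x : `|l x| <= (C + C) * `|x|.
Proof.
have C0 : 0 <= C \/ x = 0.
  have [->|x0] := eqVneq x 0; [by right | left].
  have := le_trans (normr_ge0 _) (qC (vabs_ge0 x)).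
  by rewrite pmulr_lge0// vnorm_vabs normr_gt0.
case: C0 => [C0|->]; last first.
  by rewrite /l oppr0 subrr normr0 normr0 mulr0.
rewrite (le_trans (ler_normB _ _))// mulrDl lerD//.
  by rewrite (le_trans (qC (vpos_ge0 _)))// ler_wpM2l ?vnorm_pos.
rewrite (le_trans (qC (vpos_ge0 _)))// ler_wpM2l//.
by rewrite (le_trans (vnorm_pos _))// normrN.
Qed.

Lemma cone_extension : exists f : topdual E, forall x, 0 <=v x -> f x = q x.
Proof.
exists (TopDual (bounded_continuous_functional l_linear l_bounded)) => x x0.
by rewrite /= -[x in LHS]subr0 l_sub ?vlexx// -(scale0r 0) qZ ?vlexx// mul0r subr0.
Qed.

End cone_extension.
End banach_lattice_theory.

Section topdual_lattice.
Variables (R : realType) (E : banachLatticeType R).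
Implicit Types (f g h : topdual E) (x y z : E).

Lemma riesz_kantorovich f : exists p : topdual E, forall x, 0 <=v x ->
  p x = sup [set f y | y in [set y | 0 <=v y /\ y <=v x]].
Proof.
pose S x := [set f y | y in [set y | 0 <=v y /\ y <=v x]].
have f_le x y : 0 <=v y -> y <=v x -> `|f y| <= topdual_norm f * `|x|.
  move=> y0 yx; rewrite (le_trans (topdual_norm_ub f y))//.
  by rewrite ler_wpM2l ?topdual_norm_ge0 ?vnorm_le.
have S0 x : 0 <=v x -> S x !=set0.
  by move=> x0; exists (f 0), 0; split=> //; exact: vlexx.
have Sub x : has_ubound (S x).
  exists (topdual_norm f * `|x|) => _ [y [y0 yx] <-].
  exact: le_trans (ler_norm _) (f_le _ _ y0 yx).
have leS x y : 0 <=v y -> y <=v x -> f y <= sup (S x).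
  by move=> y0 yx; apply: ub_le_sup => //; exists y.
have Sle x c : 0 <=v x -> (forall y, 0 <=v y -> y <=v x -> f y <= c) ->
    sup (S x) <= c.
  move=> x0 xc; apply: ge_sup; first exact: S0.
  by move=> _ [y [y0 yx] <-]; exact: xc.
apply: (@cone_extension _ _ (fun x => sup (S x)) (topdual_norm f)).
- move=> x y x0 y0; apply/le_anti/andP; split.
    apply: (Sle) => [|z z0 zxy]; first exact: vaddr_ge0.
    have [z1 [z2 [-> z10 z1x z20 z2y]]] := riesz_decomposition x0 y0 z0 zxy.
    by rewrite linearD lerD// leS.
  rewrite -lerBrDr; apply: (Sle) => // z1 z10 z1x.
  rewrite lerBrDr -lerBrDl; apply: (Sle) => // z2 z20 z2y.
  by rewrite lerBrDl -linearD leS ?vaddr_ge0 ?vleD.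
- have SZ_le (b : R) x : 0 < b -> 0 <=v x -> sup (S (b *: x)) <= b * sup (S x).
    move=> b0 x0; apply: (Sle) => [|y y0 yx]; first by rewrite vscale_ge0 ?ltW.
    rewrite -ler_pdivrMl// -[_ * f y]linearZ/= leS ?vscale_ge0 ?invr_ge0 ?ltW//.
    by rewrite -(vleZ2lE _ _ b0) scalerKV ?lt0r_neq0.
  move=> a x; rewrite le_eqVlt => /predU1P[<- x0|a0 x0].
    rewrite scale0r mul0r; apply/le_anti/andP; split.
      apply: (Sle) => [|y y0 yx]; first exact: vlexx.
      have -> : y = 0 by apply/vle_anti; rewrite yx y0.
      by rewrite linear0.
    by rewrite -(linear0 f) leS ?vlexx.
  apply/le_anti/andP; split; first exact: SZ_le.
  rewrite -ler_pdivlMl//; have := SZ_le a^-1 (a *: x).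
  by rewrite scalerK ?lt0r_neq0// invr_gt0; apply=> //; rewrite vscale_ge0 ?ltW.
- move=> x x0; rewrite ler_norml; apply/andP; split.
    rewrite lerNl (le_trans _ (f_le _ _ x0 (vlexx x)))// lerNl.
    rewrite (le_trans _ (leS _ _ x0 (vlexx x)))// lerNl.
    by rewrite (le_trans (ler_norm (- f x)))// normrN.
  apply: (Sle) => // y y0 yx.
  exact: le_trans (ler_norm _) (f_le _ _ y0 yx).
Qed.

Definition topdual_pos f : topdual E := projT1 (cid (riesz_kantorovich f)).

Lemma topdual_pos_ub f x y : 0 <=v y -> y <=v x -> f y <= topdual_pos f x.
Proof.
move=> y0 yx; rewrite /topdual_pos; case: cid => p /= -> //; last exact: vle_tr yx.
apply: ub_le_sup; last by exists y.
exists (topdual_norm f * `|x|) => _ [z [z0 zx] <-].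
rewrite (le_trans (ler_norm _))// (le_trans (topdual_norm_ub f z))//.
by rewrite ler_wpM2l ?topdual_norm_ge0 ?vnorm_le.
Qed.

Lemma topdual_pos_le f x (c : R) : 0 <=v x ->
  (forall y, 0 <=v y -> y <=v x -> f y <= c) -> topdual_pos f x <= c.
Proof.
move=> x0 fc; rewrite /topdual_pos; case: cid => p /= -> //.
apply: ge_sup; first by exists (f 0), 0; split=> //; exact: vlexx.
by move=> _ [y [y0 yx] <-]; exact: fc.
Qed.

Definition topdual_le f g : bool := `[< forall x, 0 <=v x -> f x <= g x >].
Definition topdual_join f g : topdual E := topdual_pos (f - g) + g.
Definition topdual_meet f g : topdual E := - topdual_join (- f) (- g).

Fact topdual_lexx : reflexive topdual_le.
Proof. by move=> f; apply/asboolP. Qed.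

Fact topdual_le_anti : antisymmetric topdual_le.
Proof.
move=> f g /andP[/asboolP fg /asboolP gf]; apply: topdual_ext => x.
rewrite -(vpos_sub x) !linearB; congr (_ - _);
  by apply/le_anti; rewrite fg ?gf ?vpos_ge0.
Qed.

Fact topdual_le_trans : transitive topdual_le.
Proof.
move=> g f h /asboolP fg /asboolP gh; apply/asboolP => x x0.
exact: le_trans (fg _ x0) (gh _ x0).
Qed.

Fact topdual_leUx f g h :
  topdual_le (topdual_join f g) h = topdual_le f h && topdual_le g h.
Proof.
apply/asboolP/andP => [jh|[/asboolP fh /asboolP gh] x x0].
  split; apply/asboolP => x x0; apply: le_trans (jh x x0); rewrite topdualDE.
    have := topdual_pos_ub (f - g) x0 (vlexx x).
    by rewrite topdualDE topdualNE lerBlDr.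
  have := topdual_pos_ub (f - g) (vlexx 0) x0.
  by rewrite linear0 lerDr.
rewrite topdualDE -lerBrDr; apply: topdual_pos_le => // y y0 yx.
rewrite topdualDE topdualNE; have := gh (x - y); rewrite vsubr_ge0 !linearB.
by move=> /(_ yx); have := fh y y0; lra.
Qed.

Let topdual_leN f g : topdual_le (- f) (- g) = topdual_le g f.
Proof.
by apply/asboolP/asboolP => fg x x0; have := fg x x0; rewrite lerN2.
Qed.

Fact topdual_lexI f g h :
  topdual_le f (topdual_meet g h) = topdual_le f g && topdual_le f h.
Proof. by rewrite -[f in LHS]opprK topdual_leN topdual_leUx !topdual_leN. Qed.

Fact topdual_leD2r h f g : topdual_le f g -> topdual_le (f + h) (g + h).
Proof.
by move=> /asboolP fg; apply/asboolP => x x0; rewrite !topdualDE lerD2r fg.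
Qed.

Fact topdual_scale_ge0 (a : R) f :
  0 <= a -> topdual_le 0 f -> topdual_le 0 (a *: f).
Proof.
move=> a0 /asboolP f0; apply/asboolP => x x0.
by rewrite topdualZE mulr_ge0//; exact: f0.
Qed.

Fact topdual_norm_abs f g :
  topdual_le (topdual_join f (- f)) (topdual_join g (- g)) -> `|f| <= `|g|.
Proof.
move=> /asboolP fg; apply: topdual_norm_le => [|x]; first exact: normr_ge0.
have absP h y : 0 <=v y -> `|h y| <= topdual_join h (- h) y.
  move=> y0; have := topdual_lexx (topdual_join h (- h)).
  rewrite topdual_leUx => /andP[/asboolP h1 /asboolP h2].
  by rewrite ler_norml lerNl h1// -topdualNE h2.
have xa : `|f x| <= topdual_join f (- f) (vabs x).
  rewrite -{1}(vpos_sub x) vabsE linearB linearD (le_trans (ler_normB _ _))//.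
  by rewrite lerD// absP ?vpos_ge0.
rewrite (le_trans xa)// (le_trans (fg _ (vabs_ge0 x)))//.
rewrite topdualDE -lerBrDr; apply: topdual_pos_le => [|y y0 yx].
  exact: vabs_ge0.
rewrite lerBrDr topdualDE topdualNE opprK topdualNE -linearD -linearB.
rewrite (le_trans (ler_norm _))// (le_trans (topdual_norm_ub g _))//.
rewrite ler_wpM2l ?topdual_norm_ge0// -(vnorm_vabs x).
apply: vnorm_abs; rewrite -/(vabs (vabs x)) (vabs_id (vabs_ge0 x)) vleUx.
rewrite opprB !vleBlDr vleD//= -vsubr_ge0 addrAC subrr add0r.
exact: vaddr_ge0.
Qed.

HB.instance Definition _ := CompleteNormedModule_isBanachLattice.Build R
  (topdual E) topdual_lexx topdual_le_anti topdual_le_trans topdual_lexI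
  topdual_leUx topdual_leD2r topdual_scale_ge0 topdual_norm_abs.

Lemma topdual_leP f g : reflect (forall x, 0 <=v x -> f x <= g x) (f <=v g).
Proof. exact: asboolP. Qed.

End topdual_lattice.

Section bidual.
Variables (R : realType) (G : normedModType R).

Definition evaluation (x : G) : topdual G -> R := fun f => f x.

Fact evaluation_continuous (x : G) :
  evaluation x \in @continuous_functional R (topdual G).
Proof.
apply: (@bounded_continuous_functional _ _ _ `|x|) => [//|f].
by rewrite mulrC; exact: topdual_norm_ub.
Qed.

Definition canonical_embedding (x : G) : topdual (topdual G) :=
  TopDual (evaluation_continuous x).

Definition weakly_null (u : nat -> G) :=
  forall f : topdual G, f (u n) @[n --> \oo] --> (0 : R).

End bidual.

(* sigma(G^*, G), the topology of pointwise convergence on G *)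
Definition weak_star (R : realType) (G : normedModType R) : Type :=
  initial_topology (fun f : topdual G => (f : G -> R) : {ptws G -> R}).

HB.instance Definition _ (R : realType) (G : normedModType R) :=
  Topological.on (weak_star G).

Section banach_lattice_notions.
Variables (R : realType) (E : banachLatticeType R).

Definition disjoint_seq (u : nat -> E) :=
  forall n k, n != k -> vmeet (vabs (u n)) (vabs (u k)) = 0.

Definition positive_schur :=
  forall u : nat -> E, (forall n, 0 <=v u n) -> weakly_null u ->
    u @ \oo --> (0 : E).

(* every net decreasing to 0 is norm null *)
Definition order_continuous_norm :=
  forall (I : Type) (leI : I -> I -> Prop) (x : I -> E),
    inhabited I ->
    (forall i, leI i i) ->
    (forall i j k, leI i j -> leI j k -> leI i k) ->
    (forall i j, exists k, leI i k /\ leI j k) ->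
    (forall i j, leI i j -> x j <=v x i) ->
    (forall i, 0 <=v x i) ->
    (forall y, (forall i, y <=v x i) -> y <=v 0) ->
  forall e : R, 0 < e -> exists i0, forall i, leI i0 i -> `|x i| < e.

Definition almost_dunford_pettis (G : completeNormedModType R) (T : E -> G) :=
  [/\ linear T, continuous T &
    forall u : nat -> E, disjoint_seq u -> weakly_null u ->
      T (u n) @[n --> \oo] --> (0 : G)].

End banach_lattice_notions.

Definition multilinear (R : realType) (m : nat) (G : 'I_m -> normedModType R)
    (H : normedModType R) (A : (forall i, G i) -> H) :=
  forall (j : 'I_m) (x : forall i, G i), linear (fun t : G j => A (dfwith x j t)).

Definition positive_multilinear (R : realType) (m : nat)
    (E : 'I_m -> banachLatticeType R) (F : banachLatticeType R)
    (A : (forall i, E i) -> F) :=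
  multilinear A /\ forall x, (forall i, 0 <=v x i) -> 0 <=v A x.

Definition separately_almost_dunford_pettis (R : realType) (m : nat)
    (E : 'I_m -> banachLatticeType R) (G : completeNormedModType R)
    (A : (forall i, E i) -> G) :=
  forall (j : 'I_m) (x : forall i, E i),
    almost_dunford_pettis (fun t : E j => A (dfwith x j t)).

Section bidual_extensions.
Variables (R : realType) (m : nat).
Variables (G : 'I_m -> completeNormedModType R) (H : completeNormedModType R).
Variables (A : (forall i, G i) -> H).
Variables (At : (forall i, topdual (topdual (G i))) -> topdual (topdual H)).

(* prod_topology is the product of the norm topologies: joint continuity *)
Definition bidual_extension :=
  [/\ multilinear At,
    continuous (At : prod_topology (fun i => topdual (topdual (G i))) ->
                     topdual (topdual H)) &
    forall x : forall i, G i,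
      At (fun i => canonical_embedding (x i)) = canonical_embedding (A x)].

Definition genuine := range At `<=` range (@canonical_embedding R H).

Definition separately_weak_star_continuous :=
  forall (j : 'I_m) (z : forall i, topdual (topdual (G i))),
    continuous ((fun t => At (dfwith z j t)) :
      weak_star (topdual (G j)) -> weak_star (topdual H)).

End bidual_extensions.

(* Main.v *)
(** Fixing all variables but the [j]-th, at positive elements, gives a positive
    weak*-weak* continuous operator [T : E_j** -> F**] with range in [J F].  It
    is the adjoint of some [S : F* -> E_j*], and since [T] takes values in
    [J F], [S] maps weak*-null sequences to weakly null ones; by the positive
    Schur property it maps positive weak*-null sequences to norm null ones.

    A disjoint weakly null sequence has weakly null positive parts, so it
    suffices to show [T v_n -> 0] for positive weakly null [v_n].  If not, after
    passing to a subsequence there are positive [phi_n] in the unit ball of [F*]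
    with [T v_n (phi_n) >= e] and [2^n (phi_0 + ... + phi_(n-1))] small at
    [T v_n].  Order continuity of the norm of [F] makes
    [psi_n = (phi_n - 2^n (phi_0 + ... + phi_(n-1)))^+] weak*-null, hence
    [S psi_n -> 0] in norm and [T v_n (psi_n) = v_n (S psi_n) -> 0], although
    [T v_n (psi_n)] stays away from [0].

    For [A] itself one applies this to [J u_n^+] and [J u_n^-], since [J] is
    isometric by the Hahn-Banach theorem. *)
Require Import Defs.
From HB Require Import structures.
From mathcomp Require Import all_boot all_order all_algebra.
From mathcomp Require Import all_classical all_reals topology normedtype.
From mathcomp Require Import sequences ring lra.
Set Implicit Arguments.
Unset Strict Implicit.
Unset Printing Implicit Defensive.
Import Order.TTheory GRing.Theory Num.Theory.
Import numFieldNormedType.Exports.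
Local Open Scope classical_set_scope.
Local Open Scope ring_scope.

(** * The Hahn-Banach theorem *)

Section sublinear.
Variables (R : realType) (V : lmodType R).
Implicit Types (p q : V -> R) (x y : V).

Definition sublinear p :=
  (forall x y, p (x + y) <= p x + p y) /\
  (forall (a : R) x, 0 < a -> p (a *: x) <= a * p x).

Lemma sublinearZ p (a : R) x : sublinear p -> 0 < a -> p (a *: x) = a * p x.
Proof.
move=> [_ pZ] a0; apply/le_anti; rewrite pZ//= -ler_pdivlMl//.
by rewrite -{1}(scalerK (lt0r_neq0 a0) x) pZ ?invr_gt0.
Qed.

Lemma sublinear0 p : sublinear p -> p 0 = 0.
Proof.
by move=> sp; have := sublinearZ 0 sp (ltr0n R 2); rewrite scaler0; lra.
Qed.

Lemma sublinear_opp p x : sublinear p -> - p (- x) <= p x.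
Proof.
by move=> sp; have := sp.1 x (- x); rewrite subrr (sublinear0 sp); lra.
Qed.

(* The largest sublinear functional [q <= p] with [q (- y) <= - p y]. *)
Definition sublinear_shift p y x : R :=
  inf [set p (x + t *: y) - t * p y | t in [set t | 0 <= t]].

Section shift.
Variables (p : V -> R) (y : V).
Hypothesis sp : sublinear p.
Let S x := [set p (x + t *: y) - t * p y | t in [set t | 0 <= t]].

Let S_neq0 x : S x !=set0.
Proof. by exists (p (x + 0 *: y) - 0 * p y), 0 => /=. Qed.

Let p_ty t : 0 <= t -> p (t *: y) = t * p y.
Proof.
rewrite le_eqVlt => /predU1P[<-|]; last exact: sublinearZ.
by rewrite scale0r mul0r sublinear0.
Qed.

Let S_lb x : lbound (S x) (- p (- x)).
Proof.
move=> _ [t /= t0 <-]; have := sp.1 (x + t *: y) (- x).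
by rewrite addrAC subrr add0r p_ty//; lra.
Qed.

Let S_has_lb x : has_lbound (S x).
Proof. by exists (- p (- x)); exact: S_lb. Qed.

Lemma sublinear_shift_ub x t : 0 <= t ->
  sublinear_shift p y x <= p (x + t *: y) - t * p y.
Proof. by move=> t0; apply: ge_inf; [exact: S_has_lb|exists t]. Qed.

Let S_inf x c : (forall t, 0 <= t -> c <= p (x + t *: y) - t * p y) ->
  c <= sublinear_shift p y x.
Proof.
by move=> xc; apply: lb_le_inf => [|_ [t t0 <-]]; [exact: S_neq0|exact: xc].
Qed.

Lemma sublinear_shift_le x : sublinear_shift p y x <= p x.
Proof. by have := sublinear_shift_ub x (lexx 0); rewrite scale0r mul0r addr0 subr0. Qed.

Lemma sublinear_shiftP : sublinear (sublinear_shift p y).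
Proof.
split=> [x z|a x a0].
  rewrite -lerBlDr; apply: S_inf => t t0.
  rewrite lerBlDr -lerBlDl; apply: S_inf => s s0; rewrite lerBlDl.
  have := sublinear_shift_ub (x + z) (addr_ge0 t0 s0).
  rewrite scalerDl addrACA => /le_trans; apply.
  by have := sp.1 (x + t *: y) (z + s *: y); rewrite mulrDl; lra.
rewrite -ler_pdivrMl//; apply: S_inf => t t0; rewrite ler_pdivrMl//.
have := sublinear_shift_ub (a *: x) (mulr_ge0 (ltW a0) t0).
by rewrite -scalerA -scalerDr (sublinearZ _ sp a0) mulrBr mulrA.
Qed.

End shift.

(** Zorn's lemma for the reversed pointwise order. A nonempty chain is bounded by its pointwise
    infimum, finite because every sublinear [q <= p] satisfies [- p (- x) <= q x]. *)
Lemma minimal_sublinear p : sublinear p -> exists q,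
  [/\ sublinear q, forall x, q x <= p x &
      forall q', sublinear q' -> (forall x, q' x <= q x) -> q' = q].
Proof.
move=> sp; pose T := {q | sublinear q /\ forall x, q x <= p x}.
pose leT (q r : T) := `[< forall x, sval r x <= sval q x >].
have [||||[q [sq qp]] qmin] := @Zorn T leT.
- by move=> q; apply/asboolP.
- move=> q r s /asboolP qr /asboolP rs; apply/asboolP => x.
  exact: le_trans (rs x) (qr x).
- move=> [q Pq] [r Pr] /asboolP/= qr /asboolP/= rq.
  apply: eq_exist; apply/funext => x.
  by apply/le_anti; rewrite qr rq.
- move=> A totA; have [[q0 Aq0]|A0] := pselect (exists q : T, A q); last first.
    exists (exist _ p (conj sp (fun x => lexx (p x)))) => s As.
    by case: A0; exists s.
  pose S x := [set sval q x | q in A].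
  have S_has_lb x : has_lbound (S x).
    exists (- p (- x)) => _ [[q [sq qp]] _ <-] /=.
    by apply: le_trans (sublinear_opp x sq); rewrite lerN2.
  have S_inf x (q : T) : A q -> inf (S x) <= sval q x.
    by move=> Aq; apply: ge_inf; [exact: S_has_lb|exists q].
  have infS x c : (forall q : T, A q -> c <= sval q x) -> c <= inf (S x).
    move=> cS; apply: lb_le_inf; first by exists (sval q0 x), q0.
    by move=> _ [q Aq <-]; exact: cS.
  have sS : sublinear (fun x => inf (S x)) /\ forall x, inf (S x) <= p x.
    split; last first.
      by move=> x; apply: le_trans (S_inf _ _ Aq0) _; case: (svalP q0).
    split=> [x y|a x a0].
      rewrite -lerBlDr; apply: (infS) => q Aq.
      rewrite lerBlDr -lerBlDl; apply: (infS) => r Ar; rewrite lerBlDl.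
      (* The smaller of the two chain members is subadditive and lies below both. *)
      have [/asboolP qr|/asboolP rq] := totA _ _ Aq Ar.
        apply: le_trans (S_inf _ _ Ar) _.
        by have [[rD _] _] := svalP r; have := rD x y; have := qr x; lra.
      apply: le_trans (S_inf _ _ Aq) _.
      by have [[qD _] _] := svalP q; have := qD x y; have := rq y; lra.
    rewrite -ler_pdivrMl//; apply: (infS) => q Aq; rewrite ler_pdivrMl//.
    apply: le_trans (S_inf _ _ Aq) _.
    by have [[_ qZ] _] := svalP q; exact: qZ.
  exists (exist _ (fun x => inf (S x)) sS) => s As.
  by apply/asboolP => x /=; exact: S_inf.
exists q; split=> // r sr rq.
have rp x : r x <= p x := le_trans (rq x) (qp x).
by have /(congr1 sval) := qmin (exist _ r (conj sr rp)) (asboolT rq).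
Qed.

(* A minimal sublinear functional equals each of its shifts, hence is additive. *)
Lemma hahn_banach_sublinear p : sublinear p -> exists f : V -> R,
  linear f /\ forall x, f x <= p x.
Proof.
move=> /minimal_sublinear[q [sq qp qmin]]; exists q; split=> //.
have qD x y : q (x + y) = q x + q y.
  apply/le_anti; rewrite sq.1/=.
  rewrite -[X in X x](qmin _ (sublinear_shiftP y sq) (sublinear_shift_le y sq)).
  rewrite -lerBrDr; have := sublinear_shift_ub y sq x ler01.
  by rewrite scale1r mul1r.
have qN x : q (- x) = - q x.
  by apply/eqP; rewrite -addr_eq0 addrC -qD subrr sublinear0.
move=> a x y; rewrite qD; congr (_ + _).
have [a0|a0|->] := ltgtP a 0; first last.
- by rewrite !scale0r sublinear0.
- exact: sublinearZ.
- rewrite -[in LHS](opprK a) scaleNr qN sublinearZ ?oppr_gt0//.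
  by rewrite /GRing.scale/= mulNr opprK.
Qed.

End sublinear.

(** A linear [f] below the shift of the norm along [x] has [f (- x)] at most minus the norm of [x]
    (take [t = 1] in the shift), so it attains the norm at [x]. *)
Lemma norming_functional (R : realType) (G : normedModType R) (x : G) :
  exists f : topdual G, `|f| <= 1 /\ f x = `|x|.
Proof.
have sN : sublinear (fun y : G => `|y|).
  by split=> [y z|a y a0]; rewrite ?ler_normD// normrZ gtr0_norm.
have [f [lf fp]] := hahn_banach_sublinear (sublinear_shiftP x sN).
have f_le y : f y <= `|y| := le_trans (fp y) (sublinear_shift_le x sN y).
pose fl : {linear G -> R} := HB.pack f (GRing.isLinear.Build R G R _ f lf).
have fN y : f (- y) = - f y by exact: (linearN fl).
have f_norm y : `|f y| <= 1 * `|y|.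
  by rewrite mul1r ler_norml f_le andbT lerNl -fN -normrN f_le.
exists (TopDual (bounded_continuous_functional lf f_norm)); split.
  exact: topdual_norm_le.
apply/le_anti; rewrite /= f_le/=.
have := le_trans (fp (- x)) (sublinear_shift_ub x sN (- x) ler01).
by rewrite fN scale1r addNr normr0 mul1r sub0r lerN2.
Qed.

Lemma norm_canonical_embedding (R : realType) (G : normedModType R) (x : G) :
  `|canonical_embedding x| = `|x|.
Proof.
apply/le_anti/andP; split.
  by apply: topdual_norm_le => // f; rewrite mulrC; exact: (topdual_norm_ub f x).
have [f [f1 fx]] := norming_functional x.
have := topdual_norm_ub (canonical_embedding x) f.
rewrite /= /evaluation fx normr_id => /le_trans; apply.
by rewrite ler_piMr// topdual_norm_ge0.
Qed.

(** * Positive parts of disjoint weakly null sequences *)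

Section disjoint_positive_parts.
Variables (R : realType) (E : banachLatticeType R).
Implicit Types (x y z w : E) (u : nat -> E) (f : topdual E).

Lemma vabsN x : vabs (- x) = vabs x.
Proof. by rewrite /vabs opprK vjoinC. Qed.

Lemma vnegE x : vpos (- x) = vpos x - x.
Proof. by rewrite -{3}(vpos_sub x) subKr. Qed.

Lemma vleDl x y : 0 <=v y -> x <=v x + y.
Proof. by move=> y0; rewrite -{1}[x]addr0 vleD ?vlexx. Qed.

(** For positive [u n] these are the positive elements disjoint from every [u n]; common lower
    bounds replace the meet, which suits Riesz decomposition. *)
Definition disjoint_cone u : set E :=
  [set w | 0 <=v w /\
    forall n z, 0 <=v z -> z <=v w -> z <=v u n -> z = 0].

Lemma disjoint_cone_solid u w z :
  disjoint_cone u w -> 0 <=v z -> z <=v w -> disjoint_cone u z.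
Proof.
move=> [w0 uw] z0 zw; split=> // n t t0 tz; apply: uw => //.
exact: vle_tr zw.
Qed.

Lemma disjoint_cone0 u : disjoint_cone u 0.
Proof. by split=> [|n z z0 z0' _]; [exact: vlexx|apply/vle_anti; rewrite z0 z0']. Qed.

Lemma disjoint_coneD u w z :
  disjoint_cone u w -> disjoint_cone u z -> disjoint_cone u (w + z).
Proof.
move=> [w0 uw] [z0 uz]; split=> [|n t t0 twz tn]; first exact: vaddr_ge0.
have [t1 [t2 [tE t10 t1w t20 t2z]]] := riesz_decomposition w0 z0 t0 twz.
have t1t : t1 <=v t by rewrite tE vleDl.
have t2t : t2 <=v t by rewrite tE addrC vleDl.
have t1E := uw n t1 t10 t1w (vle_tr t1t tn).
have t2E := uz n t2 t20 t2z (vle_tr t2t tn).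
by rewrite tE t1E t2E addr0.
Qed.

Lemma disjoint_coneZ u (a : R) w :
  0 <= a -> disjoint_cone u w -> disjoint_cone u (a *: w).
Proof.
move=> a0 [w0 uw]; split=> [|n t t0 tw tn]; first exact: vscale_ge0.
(* As [1 + a] dominates both [a] and [1], the element [(1 + a)^-1 *: t] lies below [w] and below
   [u n], also when [a = 0]. *)
have b0 : 0 < 1 + a by rewrite ltr_wpDr.
rewrite -[t](scalerKV (lt0r_neq0 b0)) (uw n ((1 + a)^-1 *: t)) ?scaler0//.
- by rewrite vscale_ge0// invr_ge0 ltW.
- rewrite -(vleZ2lE _ _ b0) scalerKV ?lt0r_neq0// scalerDl scale1r addrC.
  exact: vle_tr tw (vleDl _ _).
- apply: vle_tr tn; rewrite -(vleZ2lE _ _ b0) scalerKV ?lt0r_neq0// scalerDl.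
  by rewrite scale1r vleDl// vscale_ge0.
Qed.

(* Composition of [f] with the (possibly nonexistent) band projection onto the
   disjoint complement of [u]. *)
Lemma disjoint_cone_functional u f : 0 <=v f -> exists h : topdual E,
  (forall w, disjoint_cone u w -> h w = f w) /\
  (forall n, 0 <=v u n -> h (u n) = 0).
Proof.
move=> /topdual_leP f0.
have f_homo x y : x <=v y -> f x <= f y.
  by move=> xy; rewrite -subr_ge0 -linearB; apply: f0; rewrite vsubr_ge0.
(* A Riesz-Kantorovich supremum restricted to the cone: at a cone element it is attained at the
   element itself, and below a positive [u n] only [0] competes. *)
pose S x := [set f z | z in [set z | disjoint_cone u z /\ z <=v x]].
have leS x z : disjoint_cone u z -> z <=v x -> f z <= sup (S x).
  move=> uz zx; apply: ub_le_sup; last by exists z.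
  by exists (f x) => _ [t [_ tx] <-]; exact: f_homo.
have Sle x c : 0 <=v x -> (forall z, disjoint_cone u z -> z <=v x -> f z <= c) ->
    sup (S x) <= c.
  move=> x0 xc; apply: ge_sup.
    by exists (f 0), 0; split=> //; exact: disjoint_cone0.
  by move=> _ [z [uz zx] <-]; exact: xc.
have S_ge0 x : 0 <=v x -> 0 <= sup (S x).
  by move=> x0; rewrite -(linear0 f) leS//; exact: disjoint_cone0.
have SD x y : 0 <=v x -> 0 <=v y -> sup (S (x + y)) = sup (S x) + sup (S y).
  move=> x0 y0; apply/le_anti/andP; split.
    apply: (Sle) => [|z uz zxy]; first exact: vaddr_ge0.
    have [z1 [z2 [zE z10 z1x z20 z2y]]] := riesz_decomposition x0 y0 uz.1 zxy.
    rewrite zE linearD lerD// leS//; apply: disjoint_cone_solid uz _ _ => //.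
      by rewrite zE vleDl.
    by rewrite zE addrC vleDl.
  rewrite -lerBrDr; apply: (Sle) => // z1 uz1 z1x.
  rewrite lerBrDr -lerBrDl; apply: (Sle) => // z2 uz2 z2y.
  by rewrite lerBrDl -linearD leS ?vleD//; exact: disjoint_coneD.
have SZ a x : 0 <= a -> 0 <=v x -> sup (S (a *: x)) = a * sup (S x).
  have SZ_le (b : R) y : 0 < b -> 0 <=v y -> sup (S (b *: y)) <= b * sup (S y).
    move=> b0 y0; apply: (Sle) => [|z uz zy]; first by rewrite vscale_ge0 ?ltW.
    rewrite -ler_pdivrMl// -[_ * f z]linearZ/= leS//.
      by apply: disjoint_coneZ uz; rewrite invr_ge0 ltW.
    by rewrite -(vleZ2lE _ _ b0) scalerKV ?lt0r_neq0.
  rewrite le_eqVlt => /predU1P[<- x0|a0 x0].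
    rewrite scale0r mul0r; apply/le_anti/andP; split; last exact/S_ge0/vlexx.
    by apply: (Sle) => [|z uz z0]; [exact: vlexx|rewrite -(linear0 f) f_homo].
  apply/le_anti/andP; split; first exact: SZ_le.
  rewrite -ler_pdivlMl//; have := SZ_le a^-1 (a *: x).
  by rewrite scalerK ?lt0r_neq0// invr_gt0; apply=> //; rewrite vscale_ge0 ?ltW.
have Sbnd x : 0 <=v x -> `|sup (S x)| <= topdual_norm f * `|x|.
  move=> x0; rewrite ger0_norm ?S_ge0//; apply: (Sle) => // z uz zx.
  apply: le_trans (f_homo _ _ zx) _.
  exact: le_trans (ler_norm _) (topdual_norm_ub _ _).
have [h hE] := cone_extension SD SZ Sbnd; exists h; split=> [w uw|n un0].
  rewrite hE; last exact: uw.1.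
  apply/le_anti/andP; split; last by rewrite leS ?vlexx.
  by apply: (Sle) => [|z _]; [exact: uw.1|exact: f_homo].
rewrite hE//; apply/le_anti; rewrite S_ge0// andbT.
apply: (Sle) => // z [z0 uz] zn.
by rewrite (uz n z) ?vlexx// linear0.
Qed.

Lemma weakly_nullN u : weakly_null u -> weakly_null (fun n => - u n).
Proof.
move=> u0 f; rewrite -oppr0 (_ : (fun n => f (- u n)) = fun n => - (f (u n) : R^o)).
  by apply: (@cvgN R R^o); exact: u0.
by apply/funext => n; rewrite linearN.
Qed.

Lemma disjoint_seqN u : disjoint_seq u -> disjoint_seq (fun n => - u n).
Proof. by move=> du n k nk; rewrite !vabsN du. Qed.

(** For [f >= 0], all positive parts lie in the disjoint cone of the negative parts. The functional
    [h] that agrees with [f] on this cone and kills the negative parts gives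
    [f (vpos (u n)) = h (u n)], which tends to 0. *)
Lemma disjoint_weakly_null_pos u :
  disjoint_seq u -> weakly_null u -> weakly_null (fun n => vpos (u n)).
Proof.
move=> du u0 f.
wlog f0 : f / 0 <=v f => [pos|].
  rewrite -(subr0 0).
  rewrite (_ : (fun n => _) =
    fun n => (vpos f (vpos (u n)) : R^o) - vpos (- f) (vpos (u n))).
    by apply: (@cvgB R R^o); exact: pos (vpos_ge0 _).
  by apply/funext => n; rewrite -{1}(vpos_sub f).
have [h [hf h0]] := disjoint_cone_functional (fun n => vpos (- u n)) f0.
have cone_pos n : disjoint_cone (fun n => vpos (- u n)) (vpos (u n)).
  split=> [|k z z0 zn zk]; first exact: vpos_ge0.
  have [kn|nk] := eqVneq n k; last first.
    apply/vle_anti; rewrite z0 andbT -(du _ _ nk) vlexI.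
    rewrite (vle_tr zn (vpos_le_abs _))/=.
    by rewrite -vabsN (vle_tr zk (vpos_le_abs _)).
  (* On the diagonal, [vpos (u n) - z] still dominates both [0] and [u n], hence [vpos (u n)]. *)
  subst k; apply/vle_anti; rewrite z0 andbT.
  have: vpos (u n) <=v vpos (u n) - z.
    by rewrite {1}/vpos vleUx vsubr_ge0 zn andbT vleBrDr addrC -vleBrDr -vnegE.
  by rewrite vleBrDr -{2}[vpos (u n)]addr0 ![vpos (u n) + _]addrC vleD2rE.
rewrite (_ : (fun n => _) = fun n => h (u n)); first exact: u0.
apply/funext => n; rewrite -(hf _ (cone_pos n)).
have -> : h (u n) = h (vpos (u n)) - h (vpos (- u n)).
  by rewrite -linearB vpos_sub.
by rewrite (h0 n (vpos_ge0 _)) subr0.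
Qed.

End disjoint_positive_parts.

(** * Order continuous norms *)

Section order_continuity.
Variables (R : realType) (F : banachLatticeType R).
Implicit Types (x y z b : F) (u : nat -> F).

Lemma vle_posW x y : x <=v y -> vpos x <=v vpos y.
Proof. by move=> xy; rewrite vleUx vpos_ge0 andbT; exact: vle_tr (vleUl _ _). Qed.

Lemma vle_norm_eps x : (forall e : R, 0 < e -> `|vpos x| <= e) -> x <=v 0.
Proof.
move=> xe; have -> : 0 = vpos x; last exact: vleUl.
apply/esym/eqP; rewrite -normr_le0; apply/ler_addgt0Pl => e e0.
by rewrite addr0; exact: xe.
Qed.

(** The positive part of [x] is below that of [y] divided by [n], so its norm is arbitrarily
    small. *)
Lemma vle_archimedean x y : (forall n, x *+ n <=v y) -> x <=v 0.
Proof.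
move=> xny; apply: vle_norm_eps => e e0.
pose n := (Num.truncn (`|y| / e)).+1.
have n0 : 0 < n%:R :> R by rewrite ltr0n.
have ne : `|y| <= n%:R * e.
  by rewrite -ler_pdivrMr// ltW// truncnS_gt.
have : vpos x <=v n%:R^-1 *: vpos y.
  rewrite vleUx vscale_ge0 ?invr_ge0 ?ltW ?vpos_ge0// andbT.
  rewrite -(vleZ2lE _ _ n0) scalerKV ?lt0r_neq0// scaler_nat.
  exact: vle_tr (xny n) (vleUl _ _).
move=> /(vnorm_le (vpos_ge0 x)); rewrite normrZ normfV normr_nat => /le_trans.
apply; rewrite ler_pdivrMl//; exact: le_trans (vnorm_pos y) ne.
Qed.

Lemma vle_lim u l b : u @ \oo --> l -> (forall n, u n <=v b) -> l <=v b.
Proof.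
move=> /cvgrPdist_le ul ub; rewrite -(subrK b l) -vleBrDr subrr.
apply: vle_norm_eps => e e0; have [N _ /(_ N (leqnn N)) lN] := ul _ e0.
apply: le_trans lN; apply: le_trans (vnorm_pos _).
by rewrite vnorm_le ?vpos_ge0// vle_posW// vleD ?vlexx// vleN2.
Qed.

Lemma vge_lim u l b : u @ \oo --> l -> (forall n, b <=v u n) -> b <=v l.
Proof.
move=> ul bu; rewrite -vleN2; apply: (@vle_lim (fun n => - u n)).
  exact: cvgN.
by move=> n; rewrite vleN2.
Qed.

Lemma vle_nondecreasing u : (forall n, u n <=v u n.+1) ->
  forall m n, (m <= n)%N -> u m <=v u n.
Proof.
move=> uS m n; elim: n => [|n IH]; first by rewrite leqn0 => /eqP ->; exact: vlexx.
rewrite leq_eqVlt => /predU1P[->|]; first exact: vlexx.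
by rewrite ltnS => /IH mn; exact: vle_tr mn (uS n).
Qed.

(** No supremum of [u] is available beforehand. The net of differences [c - u n], over all upper
    bounds [c] of [u] and all [n], decreases to 0; its norm convergence makes [u] Cauchy. *)
Lemma order_continuous_norm_cvg u b : order_continuous_norm F ->
  (forall n, u n <=v u n.+1) -> (forall n, u n <=v b) -> cvg (u @ \oo).
Proof.
move=> ocF uS ub.
pose I := {p : F * nat | forall n, u n <=v p.1}.
pose leI (p q : I) := (sval q).1 <=v (sval p).1 /\ ((sval p).2 <= (sval q).2)%N.
pose x (p : I) := (sval p).1 - u (sval p).2.
apply: cauchy_cvg; apply/cauchy_exP => e e0.
have [||||||| [[b0 n0] /= ub0] xe] := ocF I leI x _ _ _ _ _ _ _ e e0.
- by exists; exists (b, 0%N).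
- by move=> p; split=> //; exact: vlexx.
- move=> p q r [pq1 pq2] [qr1 qr2].
  by split; [exact: vle_tr qr1 pq1|exact: leq_trans pq2 qr2].
- move=> [[a m] /= ua] [[c n] /= uc].
  have uac k : u k <=v vmeet a c by rewrite vlexI ua uc.
  exists (exist _ (vmeet a c, maxn m n) uac).
  by rewrite /leI/= vleIl vleIr leq_maxl leq_maxr.
- move=> p q [pq1 pq2]; apply: vleD => //; rewrite vleN2.
  exact: vle_nondecreasing.
- by move=> [[a m] /= ua]; rewrite /x/= vsubr_ge0.
(* Subtracting [y] from an upper bound of [u] gives another one; iterating from [b] yields
   [y *+ k <= b - u 0] for all [k]. *)
- move=> y yx; apply: (@vle_archimedean _ (b - u 0%N)) => k.
  suff : forall n, u n <=v b - y *+ k.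
    by move=> /(_ 0%N); rewrite !vleBrDr addrC.
  elim: k => [n|k IH n]; first by rewrite mulr0n subr0.
  have := yx (exist _ (b - y *+ k, n) IH); rewrite /x/= vleBrDr addrC -vleBrDr.
  by rewrite -addrA -opprD -mulrSr.
exists (u n0); near=> n.
have n0n : (n0 <= n)%N by near: n; exact: nbhs_infty_ge.
rewrite -ball_normE/= distrC.
have leII : leI (exist _ (b0, n0) ub0) (exist _ (b0, n0) ub0).
  by split=> //; exact: vlexx.
apply: le_lt_trans (xe _ leII); rewrite vnorm_le//.
  by rewrite vsubr_ge0 vle_nondecreasing.
by rewrite /x/= vleD// vlexx.
Unshelve. all: by end_near. Qed.

End order_continuity.

(** * Weak*-null sequences of positive functionals *)

Section weak_star_null.
Variables (R : realType) (F : banachLatticeType R).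
Hypothesis ocF : order_continuous_norm F.
Implicit Types (x y z : F).

Lemma topdual_homo (f : topdual F) x y : 0 <=v f -> x <=v y -> f x <= f y.
Proof.
move=> /topdual_leP f0 xy.
by rewrite -subr_ge0 -linearB; apply: f0; rewrite vsubr_ge0.
Qed.

Lemma topdual_sumE n (f : nat -> topdual F) x :
  (\sum_(k < n) f k) x = \sum_(k < n) f k x.
Proof. exact: (big_morph (fun g : topdual F => g x)). Qed.

Lemma le0_of_exp2_bound (a b : R) k :
  (forall n, (k < n)%N -> a * 2 ^+ n <= b) -> a <= 0.
Proof.
move=> ab; rewrite leNgt; apply/negP => a0.
pose n := (Num.truncn (b / a) + k).+1.
have := ab n; rewrite /n ltnS leq_addl => /(_ isT).
apply/negP; rewrite -ltNge -ltr_pdivrMl// mulrC.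
apply: lt_le_trans (truncnS_gt _) _.
rewrite -natrX ler_nat (leq_trans _ (ltnW (ltn_expl _ _)))//.
by rewrite ltnS leq_addr.
Qed.

(* If [psi_n x >= d] for infinitely many [n], pick [0 <= z_n <= x] almost
   attaining [psi_n x].  The order limsup [v] of the [z_n] is a norm limit;
   every [phi_k] vanishes on it, yet [phi_n v] stays away from [0]. *)
Lemma weak_star_null_pos (phi : nat -> topdual F) :
  (forall n, 0 <=v phi n) -> (forall n, `|phi n| <= 1) ->
  forall x, 0 <=v x ->
  topdual_pos (phi n - 2 ^+ n *: \sum_(k < n) phi k) x @[n --> \oo] --> (0 : R).
Proof.
move=> phi0 phi1 x x0.
pose psi n := topdual_pos (phi n - 2 ^+ n *: \sum_(k < n) phi k).
change (psi n x @[n --> \oo] --> (0 : R)).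
have psi_ge0 n : 0 <= psi n x.
  have := topdual_pos_ub (phi n - 2 ^+ n *: \sum_(k < n) phi k) (vlexx 0) x0.
  by rewrite linear0.
have phi_le n z : `|phi n z| <= `|z|.
  by rewrite (le_trans (topdual_norm_ub _ _))// ler_piMl// phi1.
apply/cvgrPdist_lt => d d0.
have [//|often] := pselect (\forall n \near \oo, `|0 - psi n x| < d).
exfalso.
have {}often N : exists2 n, (N <= n)%N & d <= psi n x.
  apply: contrapT => noN; apply: often; exists N => // n /= Nn.
  rewrite sub0r normrN ger0_norm ?psi_ge0// ltNge; apply/negP => dn.
  by apply: noN; exists n.
(* If [psi n x >= d], some [y] in [[0, x]] has [phi n y - 2 ^+ n * (sum of the earlier phi k y) > d
   / 2]. Since [phi n y] is at most the norm of [x], both estimates follow. At other indices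
   [z n = 0]. *)
have /choice[z zP] n : exists z, [/\ 0 <=v z, z <=v x,
    (\sum_(k < n) phi k) z * 2 ^+ n <= `|x| &
    d <= psi n x -> d / 2 <= phi n z].
  have [dn|nd] := leP d (psi n x); last first.
    exists 0; split=> //; first exact: vlexx.
    by rewrite linear0 mul0r.
  have s0 y : 0 <=v y -> 0 <= (\sum_(k < n) phi k) y.
    move=> y0; rewrite topdual_sumE; apply: sumr_ge0 => k _.
    exact: (topdual_leP _ _ (phi0 k)).
  apply: contrapT => noz.
  have : psi n x <= d / 2; last by lra.
  apply: topdual_pos_le => // y y0 yx; rewrite leNgt; apply/negP => dy.
  apply: noz; exists y; move: dy; rewrite topdualDE topdualNE topdualZE => dy.
  have cs0 := mulr_ge0 (exprn_ge0 n (ler0n R 2)) (s0 y y0).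
  have phiy : phi n y <= `|x|.
    by rewrite (le_trans (ler_norm _))// (le_trans (phi_le _ _))// vnorm_le.
  split=> //; [rewrite mulrC; lra|move=> _; lra].
have z_ge0 n : 0 <=v z n by have [] := zP n.
have phi_z k n : (k < n)%N -> phi k (z n) <= `|x| * (2 ^+ n)^-1.
  move=> kn; have [_ _ + _] := zP n; rewrite -ler_pdivlMr ?exprn_gt0//.
  apply: le_trans; rewrite topdual_sumE (bigD1 (Ordinal kn))//= lerDl.
  by apply: sumr_ge0 => i _; exact: (topdual_leP _ _ (phi0 i)).
(* [j n N] is the join of [z n, ..., z (n + N)]; its limit [v n] in [N] is the supremum of the
   tail. *)
pose j n := fix j N := if N is M.+1 then vjoin (j M) (z (n + M.+1)%N) else z n.
have jS n N : j n N.+1 = vjoin (j n N) (z (n + N.+1)%N) by [].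
have j_incr n N : j n N <=v j n N.+1 by rewrite jS vleUl.
have j_le n N : j n N <=v x.
  elim: N => [|N IH]; first by have [] := zP n.
  by rewrite jS vleUx IH/=; have [] := zP (n + N.+1)%N.
have j_shift n N : j n.+1 N <=v j n N.+1.
  elim: N => [|N IH]; first by rewrite jS addn1 vleUr.
  rewrite [j n.+1 _]jS vleUx addSnnS (vle_tr IH (j_incr _ _)) andTb.
  exact: vleUr.
(* The factor is the geometric sum of [2 ^- i] for [n <= i <= n + N]. *)
have phi_j k n N : (k < n)%N ->
    phi k (j n N) <= `|x| * (2 * (2 ^+ n)^-1 - (2 ^+ (n + N))^-1).
  move=> kn; elim: N => [|N IH].
    by rewrite addn0 mulr_natl mulr2n addrK; exact: phi_z.
  have : phi k (j n N.+1) <= phi k (j n N) + phi k (z (n + N.+1)%N).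
    rewrite -linearD; apply: topdual_homo => //; rewrite jS vleUx.
    rewrite vleDl// addrC vleDl//.
    by apply: (vle_tr (z_ge0 n)); exact: (@vle_nondecreasing _ _ (j n) (j_incr n) 0).
  have := phi_z k (n + N.+1)%N (ltn_addr _ kn).
  rewrite addnS exprS invfM => h1 h2.
  have := IH; have -> : (2 ^+ (n + N))^-1 = 2 * (2^-1 * (2 ^+ (n + N))^-1) :> R.
    by rewrite mulrA divff ?mul1r// pnatr_eq0.
  by move: h1 h2; set t := _ * _^-1; nra.
have cvg_j n : cvg (j n @ \oo) := order_continuous_norm_cvg ocF (j_incr n) (j_le n).
pose v n := lim (j n @ \oo).
have j_le_v n N : j n N <=v v n.
  apply: (@vge_lim _ _ (fun M => j n (M + N)%N)).
    by apply: cvg_comp (cvg_j n); exact: cvg_addnr.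
  by move=> M; apply: vle_nondecreasing => //; exact: leq_addl.
have v_decr n : v n.+1 <=v v n.
  apply: (vle_lim (cvg_j n.+1)) => N.
  exact: vle_tr (j_shift n N) (j_le_v _ _).
have phi_v k n : (k < n)%N -> phi k (v n) * 2 ^+ n <= `|x| * 2.
  move=> kn; rewrite -ler_pdivlMr ?exprn_gt0//.
  have cphi : (phi k (j n N) : R^o) @[N --> \oo] --> (phi k (v n) : R^o).
    by apply: continuous_cvg; [exact: topdual_continuous|exact: cvg_j].
  apply: (closed_cvg [set t : R | t <= `|x| * 2 / 2 ^+ n] _ _ _ cphi).
    exact: closed_le.
  apply: nearW => N /=; rewrite (le_trans (phi_j k n N kn))// -mulrA.
  by rewrite ler_wpM2l// gerBl invr_ge0 exprn_ge0.
have cvg_v : cvg (v @ \oo).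
  have vx n : v n <=v x by exact: vle_lim (cvg_j n) (j_le n).
  have cvgN_v : cvg ((fun n => - v n) @ \oo).
    apply: (@order_continuous_norm_cvg _ _ (fun n => - v n) 0) => // n.
      by rewrite vleN2.
    rewrite -oppr0 vleN2; apply: vle_tr (z_ge0 n) _; exact: (j_le_v n 0%N).
  rewrite (_ : v = fun n => - - v n); last by apply/funext => n; rewrite opprK.
  exact: is_cvgN.
pose w := lim (v @ \oo).
have w_le_v n : w <=v v n.
  rewrite -vleN2; apply: (@vge_lim _ _ (fun M => - v (M + n)%N)).
    by apply: cvgN; apply: cvg_comp cvg_v; exact: cvg_addnr.
  move=> M; apply: (@vle_nondecreasing _ _ (fun M => - v M)) => [i|].
    by rewrite vleN2.
  exact: leq_addl.
have phi_w k : phi k w <= 0.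
  apply: (@le0_of_exp2_bound _ (`|x| * 2) k) => n kn.
  apply: le_trans (phi_v k n kn); rewrite ler_wpM2r ?exprn_ge0//.
  exact: topdual_homo.
have d20 : 0 < d / 2 by rewrite divr_gt0.
have /cvgrPdist_lt/(_ _ d20)[N _ vN] := cvg_v.
(* Here [phi n (v n - w) >= phi n (z n) >= d / 2], while [v n - w] has norm below [d / 2]. *)
have [n Nn dn] := often N; have [_ _ _ /(_ dn) phin] := zP n.
have := vN n Nn; apply/negP; rewrite -leNgt distrC.
apply: le_trans (phi_le n _); apply: le_trans (ler_norm _).
rewrite linearB; have := topdual_homo (phi0 n) (j_le_v n 0%N).
by have := phi_w n; move: phin => /=; lra.
Qed.

End weak_star_null.

(** * Weak* continuous operators between duals *)

Section weak_star_continuity.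
Variables (R : realType) (X : normedModType R).
Implicit Types (t : topdual X) (L : topdual X -> R) (s : seq X).

(** Induction on [s]: if some [v] vanishes on [s] but not at [x], subtracting the multiple
    [L v / v x] of evaluation at [x] reduces to [s]; otherwise vanishing on [s] already forces
    vanishing at [x]. *)
Lemma evaluation_of_kernel s L : linear L ->
  (forall t, (forall x, x \in s -> t x = 0) -> L t = 0) ->
  exists x, forall t, L t = t x.
Proof.
elim: s L => [|x s IH] L lL ker.
  by exists 0 => t; rewrite linear0; exact: ker.
have [[v [vs vx]]|nov] :=
    pselect (exists v : topdual X, (forall y, y \in s -> v y = 0) /\ v x <> 0).
  have {}vx : v x != 0 by exact/eqP.
  pose c := L v / v x.
  have lLc : linear (fun t => L t - c * t x).
    by move=> a t u; rewrite lL topdualDE topdualZE /GRing.scale/=; ring.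
  have [|y yE] := IH _ lLc.
    (* The correction by a multiple of [v] makes [t] vanish at [x] as well. *)
    move=> t ts; have : L (- (t x / v x) *: v + t) = 0.
      apply: ker => y; rewrite inE => /orP[/eqP->|ys].
        by rewrite topdualDE topdualZE mulNr divfK// addNr.
      by rewrite topdualDE topdualZE (vs _ ys) mulr0 add0r; exact: ts.
    rewrite lL /GRing.scale/= /c => Lt.
    by rewrite -[RHS]Lt; field.
  exists (y + c *: x) => t; rewrite linearD linearZ/=.
  by have := yE t; rewrite /GRing.scale/=; lra.
apply: IH => // t ts; apply: ker => y; rewrite inE => /orP[/eqP->|/ts//].
by apply: contrapT => tx; apply: nov; exists t.
Qed.

(** The filter generated by annihilators of finite sets. It converges weak* to 0, and its basic sets
    are linear subspaces. *)
Let zero_on : set_system (topdual X) :=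
  [set A | exists s, forall t, (forall x, x \in s -> t x = 0) -> A t].

Let zero_on_filter : Filter zero_on.
Proof.
split; first by exists [::].
- move=> A B [s1 A1] [s2 B2]; exists (s1 ++ s2) => t t0; split.
    by apply: A1 => x xs; apply: t0; rewrite mem_cat xs.
  by apply: B2 => x xs; apply: t0; rewrite mem_cat xs orbT.
- by move=> A B AB [s As]; exists s => t /As /AB.
Qed.

#[local] Existing Instance zero_on_filter.

Let zero_on_cvg : zero_on --> (0 : weak_star X).
Proof.
have ptws0 : (fun t : topdual X => (t : X -> R) : {ptws X -> R}) @ zero_on -->
    ((fun=> 0) : {ptws X -> R}).
  apply/cvg_sup => x A [_ [[B _ <-] B0] BA]; exists [:: x] => t tx; apply: BA.
  by rewrite /= tx ?inE.
move=> A [_ [[B Bop <-] B0] BA].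
have /ptws0[s Bs] : nbhs ((fun=> 0) : {ptws X -> R}) B by exact: open_nbhs_nbhs.
by exists s => t /Bs; exact: BA.
Qed.

Lemma weak_star_continuous_evaluation L :
  linear L -> continuous (L : weak_star X -> R) -> exists x, forall t, L t = t x.
Proof.
move=> lL cL; have L0 : L 0 = 0.
  by have := lL 1 0 0; rewrite !scale1r addr0; lra.
have LZ (a : R) t : L (a *: t) = a * L t.
  by have := lL a t 0; rewrite L0 !addr0.
have : L @ zero_on --> L (0 : weak_star X).
  apply: cvg_trans (cL (0 : weak_star X)).
  by apply: cvg_app; exact: zero_on_cvg.
move=> /cvgrPdist_lt/(_ 1 ltr01)[s Ls]; apply: (@evaluation_of_kernel s) => // t ts.
(* [L] is bounded by 1 on a subspace; rescaling [t] to [L]-value 1 shows that [L] vanishes there. *)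
apply/eqP/negPn/negP => Lt.
have Lts x : x \in s -> ((L t)^-1 *: t) x = 0.
  by move=> xs; rewrite topdualZE ts// mulr0.
by have := Ls _ Lts; rewrite /= L0 LZ mulVf// sub0r normrN normr1 ltxx.
Qed.

End weak_star_continuity.

Lemma evaluation_weak_star_continuous (R : realType) (Y : normedModType R)
    (y : Y) : continuous ((fun t : topdual Y => t y) : weak_star Y -> R).
Proof.
move=> t; pose h (t : topdual Y) : {ptws Y -> R} := t : Y -> R.
apply: (@cvg_comp _ _ _ h (fun g : {ptws Y -> R} => g y) _ (nbhs (h t))).
  exact: (@initial_continuous _ _ h t).
exact: (@proj_continuous Y (fun=> R) y (h t)).
Qed.

Lemma weak_star_continuous_adjoint (R : realType) (X Y : normedModType R)
    (T : topdual X -> topdual Y) : linear T ->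
  continuous (T : weak_star X -> weak_star Y) ->
  exists S : Y -> X, forall t y, T t y = t (S y).
Proof.
move=> lT cT; have /choice[S SE] y : exists x, forall t, T t y = t x.
  apply: weak_star_continuous_evaluation => [a t u|t]; first by rewrite lT.
  have evy := @evaluation_weak_star_continuous R Y y.
  exact: (continuous_comp (cT t) (evy (T t))).
by exists S => t y; exact: SE.
Qed.

(** Uniform boundedness principle: pointwise convergent sequences are pointwise bounded. *)
Lemma weak_star_null_bounded (R : realType) (X : completeNormedModType R)
    (v : nat -> topdual X) : (forall x, v n x @[n --> \oo] --> (0 : R)) ->
  exists M, forall n, `|v n| <= M.
Proof.
move=> v0; pose B : set (X -> R^o) := [set (v n : X -> R) | n in setT].
have [||M BM] := @Banach_Steinhauss R X R^o B _ _ 1.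
- move=> _ [n _ <-]; split; last exact: topdual_linear.
  move=> r; exists (topdual_norm (v n) * r) => x xr.
  by rewrite (le_trans (topdual_norm_ub _ _))// ler_wpM2l ?topdual_norm_ge0.
- move=> x; have /cvg_seq_bounded/pinfty_ex_gt0[M _ xM] : cvg ((v n x : R^o) @[n --> \oo]).
    by apply/cvg_ex; exists 0; exact: v0.
  by exists M => _ [n _ <-]; exact: xM.
exists M => n; apply: ge_sup.
  by exists `|v n 0|, 0 => //=; rewrite normr0.
by move=> _ [x x1 <-]; apply: BM => //; exists n.
Qed.

(** * Positive weak*-weak* continuous operators with range in the canonical copy of [F] *)

Section positive_adjoint.
Variables (R : realType) (E F : banachLatticeType R).
Variable T : topdual (topdual E) -> topdual (topdual F).
Hypotheses (schurE : positive_schur (topdual E)) (ocF : order_continuous_norm F).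
Hypotheses (linT : linear T)
  (wsT : continuous (T : weak_star (topdual E) -> weak_star (topdual F))).
Hypotheses (posT : forall t, 0 <=v t -> 0 <=v T t)
  (genT : range T `<=` range (@canonical_embedding R F)).

Lemma canonical_embedding_ge0 (G : banachLatticeType R) (x : G) :
  0 <=v x -> 0 <=v canonical_embedding x.
Proof. by move=> x0; apply/topdual_leP => f /topdual_leP; exact. Qed.

(** For positive [Y], the absolute value of [Y g] is at most [Y (vabs g)], and [vabs g] has the norm
    of [g]. *)
Lemma positive_norm_le (G : banachLatticeType R) (Y : topdual G) (e : R) :
  0 <= e -> 0 <=v Y -> (forall g, 0 <=v g -> `|g| <= 1 -> Y g <= e) -> `|Y| <= e.
Proof.
move=> e0 Y0 Ye; apply: topdual_norm_le => // g.
have [->|g0] := eqVneq g 0; first by rewrite linear0 !normr0 mulr0.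
have {}g0 : 0 < `|g| by rewrite normr_gt0.
have Yabs : `|Y g| <= Y (vabs g).
  rewrite ler_norml lerNl -linearN.
  by rewrite !topdual_homo ?vleUl ?vleUr.
apply: (le_trans Yabs); rewrite -ler_pdivrMr// mulrC -[_ * _]linearZ/=.
apply: Ye; first by rewrite vscale_ge0 ?vabs_ge0// invr_ge0 ltW.
by rewrite normrZ vnorm_vabs normfV normr_id mulVf// lt0r_neq0.
Qed.

Lemma schur_adjoint_norm_null (v : nat -> topdual (topdual E)) :
  (forall n, 0 <=v v n) -> weakly_null v -> T (v n) @[n --> \oo] --> 0.
Proof.
move=> v0 vw; have [S SE] := weak_star_continuous_adjoint linT wsT.
have v_cvg g : v n g @[n --> \oo] --> (0 : R) by exact: (vw (canonical_embedding g)).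
have [M vM] := weak_star_null_bounded v_cvg.
have M0 : 0 <= M by exact: le_trans (normr_ge0 _) (vM 0%N).
apply/cvgrPdist_lt => e e0.
have [//|often] := pselect (\forall n \near \oo, `|0 - T (v n)| < e).
exfalso.
have e20 : 0 < e / 2 by rewrite divr_gt0.
have e40 : 0 < e / 4 by rewrite divr_gt0.
(* For each [g], the values [T (v n) g = v n (S g)] tend to 0, while the norm of [T (v n)] is at
   least [e] infinitely often; one index [n] serves both demands. *)
have /choice[p pP] (g : topdual F) : exists p : topdual F * nat,
    [/\ 0 <=v p.1, `|p.1| <= 1, e / 2 <= T (v p.2) p.1 & T (v p.2) g <= e / 4].
  have /cvgrPdist_lt/(_ _ e40)[N _ vN] := v_cvg (S g).
  have [n Nn en] : exists2 n, (N <= n)%N & e <= `|T (v n)|.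
    apply: contrapT => noN; apply: often; exists N => // n /= Nn.
    rewrite sub0r normrN ltNge; apply/negP => en.
    by apply: noN; exists n.
  apply: contrapT => nop.
  have : `|T (v n)| <= e / 2; last by lra.
  apply: positive_norm_le; [exact: ltW|exact: posT|move=> f f0 f1].
  rewrite leNgt; apply/negP => ef; apply: nop; exists (f, n); split=> //=.
    exact: ltW.
  rewrite SE; have := vN n Nn; rewrite sub0r normrN => /ltW.
  exact: le_trans (ler_norm _).
(* Gliding hump: [s i] sums the functionals chosen before stage [i], and the next pair is chosen
   against [2 ^+ i *: s i]. *)
pose s := fix s i : topdual F :=
  if i is k.+1 then s k + (p (2 ^+ k *: s k)).1 else 0.
pose phi i := (p (2 ^+ i *: s i)).1; pose w i := v (p (2 ^+ i *: s i)).2.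
have sE i : s i = \sum_(k < i) phi k.
  elim: i => [|i IH]; first by rewrite big_ord0.
  by rewrite big_ord_recr/= -IH.
have phi0 i : 0 <=v phi i by have [] := pP (2 ^+ i *: s i).
have phi1 i : `|phi i| <= 1 by have [] := pP (2 ^+ i *: s i).
pose psi i := topdual_pos (phi i - 2 ^+ i *: s i).
have psi_ge0 i : 0 <=v psi i.
  apply/topdual_leP => x x0.
  have := topdual_pos_ub (phi i - 2 ^+ i *: s i) (vlexx 0) x0.
  by rewrite linear0.
have psi_cvg x : psi i x @[i --> \oo] --> (0 : R).
  have pos y : 0 <=v y -> psi i y @[i --> \oo] --> (0 : R).
    move=> y0; have := weak_star_null_pos ocF phi0 phi1 y0.
    by under eq_fun do rewrite -sE.
  rewrite -(subr0 0) (_ : (fun i => _) =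
    fun i => (psi i (vpos x) : R^o) - psi i (vpos (- x))).
    by apply: (@cvgB R R^o); exact/pos/vpos_ge0.
  by apply/funext => i; rewrite -linearB vpos_sub.
have Spsi_cvg : S (psi i) @[i --> \oo] --> (0 : topdual E).
  apply: schurE => [i|t].
    apply/topdual_leP => x x0; have := canonical_embedding_ge0 x0.
    by move=> /posT/topdual_leP/(_ _ (psi_ge0 i)); rewrite SE.
  (* As [T t] is evaluation at some [x] in [F], [t (S (psi i))] equals [psi i x]: weak*-null becomes
     weakly null. *)
  have [x _ xE] := genT (imageT T t).
  rewrite (_ : (fun i => _) = fun i => psi i x); first exact: psi_cvg.
  by apply/funext => i; rewrite -SE -xE.
(* Contradiction: [w i (S (psi i)) = T (w i) (psi i) >= e / 2 - e / 4]. The bound [M + 1] keeps the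
   divisor positive. *)
have Md0 : 0 < e / 4 / (M + 1) by rewrite divr_gt0// ltr_wpDl.
have /cvgrPdist_lt/(_ _ Md0)[i _ /(_ i (leqnn i))] := Spsi_cvg.
apply/negP; rewrite -leNgt sub0r normrN ler_pdivrMr ?ltr_wpDl// [leRHS]mulrC.
have : T (w i) (phi i - 2 ^+ i *: s i) <= T (w i) (psi i).
  apply: topdual_homo; first exact/posT/v0.
  by apply/topdual_leP => x x0; exact: topdual_pos_ub (vlexx x).
have [_ _] := pP (2 ^+ i *: s i); rewrite -/(phi i) -/(w i) => h1 h2.
rewrite linearB SE => h3.
have := le_trans (ler_norm _) (topdual_norm_ub (w i) (S (psi i))).
have := ler_wpM2r (normr_ge0 (S (psi i))) (vM (p (2 ^+ i *: s i)).2).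
rewrite -/(w i) mulrDl mul1r => h4 h5.
have := normr_ge0 (S (psi i)); move: h1 h2 h3 h4 h5.
rewrite topdual_normE; lra.
Qed.

End positive_adjoint.

(** * Bidual extensions *)

Section canonical_embedding_theory.
Variables (R : realType) (G : normedModType R).

Lemma canonical_embeddingB (x y : G) :
  canonical_embedding (x - y) = canonical_embedding x - canonical_embedding y.
Proof. by apply: topdual_ext => f; exact: (linearB f). Qed.

Lemma canonical_embedding_linear : linear (@canonical_embedding R G).
Proof. by move=> a x y; apply: topdual_ext => f; exact: (linearP f). Qed.

Lemma cvg_canonical_embedding (T : Type) (B : set_system T) (g : T -> G) l :
  Filter B -> canonical_embedding (g t) @[t --> B] --> canonical_embedding l <->
  g @ B --> l.
Proof.
by move=> FB; split=> /cvgrPdist_lt gl; apply/cvgrPdist_lt => e /gl; apply: filterS => t;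
  rewrite -canonical_embeddingB norm_canonical_embedding.
Qed.

Lemma weakly_null_canonical_embedding (u : nat -> G) :
  weakly_null u -> weakly_null (fun n => canonical_embedding (u n)).
Proof.
move=> u0 L; have lLJ : linear (fun x => L (canonical_embedding x)).
  by move=> a x y; rewrite canonical_embedding_linear linearP.
have LJ_le x : `|L (canonical_embedding x)| <= topdual_norm L * `|x|.
  by rewrite -norm_canonical_embedding; exact: topdual_norm_ub.
exact: (u0 (TopDual (bounded_continuous_functional lLJ LJ_le))).
Qed.

End canonical_embedding_theory.

(** * Replacing single coordinates of a tuple *)

Lemma dfwithC (I : eqType) (T : I -> Type) (x : forall i, T i) i j
    (a : T i) (b : T j) : i != j ->
  dfwith (dfwith x i a) j b = dfwith (dfwith x j b) i a.
Proof.
move=> ij; apply: functional_extensionality_dep => k.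
have [kj|jk] := eqVneq j k.
  by subst k; rewrite dfwithin dfwithout// dfwithin.
rewrite dfwithout//; have [ki|ik] := eqVneq i k.
  by subst k; rewrite !dfwithin.
by rewrite !dfwithout.
Qed.

Lemma dfwith_idem (I : eqType) (T : I -> Type) (x : forall i, T i) j
    (a b : T j) : dfwith (dfwith x j a) j b = dfwith x j b.
Proof.
apply: functional_extensionality_dep => k; have [kj|jk] := eqVneq j k.
  by subst k; rewrite !dfwithin.
by rewrite !dfwithout.
Qed.

Lemma dfwith_id (I : eqType) (T : I -> Type) (x : forall i, T i) j :
  dfwith x j (x j) = x.
Proof.
apply: functional_extensionality_dep => k; have [kj|jk] := eqVneq j k.
  by subst k; rewrite dfwithin.
by rewrite dfwithout.
Qed.

Lemma dfwith_map (I : eqType) (T U : I -> Type) (f : forall i, T i -> U i)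
    (x : forall i, T i) j (a : T j) :
  (fun i => f i (dfwith x j a i)) = dfwith (fun i => f i (x i)) j (f j a).
Proof.
apply: functional_extensionality_dep => k; have [kj|jk] := eqVneq j k.
  by subst k; rewrite !dfwithin.
by rewrite !dfwithout.
Qed.

Lemma multilinearB (R : realType) (m : nat) (G : 'I_m -> normedModType R)
    (H : normedModType R) (A : (forall i, G i) -> H) j (x : forall i, G i) a b :
  multilinear A -> A (dfwith x j (a - b)) = A (dfwith x j a) - A (dfwith x j b).
Proof.
move=> mA; rewrite [a - b]addrC -scaleN1r.
by have /= -> := mA j x (- 1) b a; rewrite scaleN1r addrC.
Qed.

(** * Fixed coordinates of arbitrary sign *)

Section genuine_bidual_extension.
Variables (R : realType) (m : nat) (E : 'I_m -> banachLatticeType R).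
Variables (F : banachLatticeType R).
Hypotheses (schurE : forall i, positive_schur (topdual (E i)))
  (ocF : order_continuous_norm F).
Variable At : (forall i, topdual (topdual (E i))) -> topdual (topdual F).
Hypotheses (posAt : positive_multilinear At) (genAt : genuine At)
  (wsAt : separately_weak_star_continuous At).

Lemma genuine_extension_cvg_pos j (x : forall i, topdual (topdual (E i)))
    (v : nat -> topdual (topdual (E j))) :
  (forall n, 0 <=v v n) -> weakly_null v ->
  At (dfwith x j (v n)) @[n --> \oo] --> 0.
Proof.
(* Induction on a list [s] containing all coordinates whose sign is unrestricted; each step splits
   one of them into positive and negative parts. *)
move=> v0 vw; suff : forall (s : seq 'I_m) y, (forall i, i \notin s -> 0 <=v y i) ->
    At (dfwith y j (v n)) @[n --> \oo] --> 0.
  by move=> /(_ (enum 'I_m) x); apply => i; rewrite mem_enum.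
elim=> [|i s IH] y y0.
  apply: (@schur_adjoint_norm_null _ _ _ (fun t => At (dfwith y j t))
    (schurE (i := j)) ocF (posAt.1 j y)) => //.
  - exact: wsAt.
  - move=> t t0; apply: posAt.2 => i; have [ij|ji] := eqVneq j i.
      by subst i; rewrite dfwithin.
    by rewrite dfwithout// y0.
  - by move=> _ [t _ <-]; exact: genAt.
have IHi a : 0 <=v a -> At (dfwith (dfwith y i a) j (v n)) @[n --> \oo] --> 0.
  move=> a0; apply: IH => k ks; have [ik|ki] := eqVneq i k.
    by subst k; rewrite dfwithin.
  by rewrite dfwithout// y0// inE negb_or eq_sym ki.
have [ij|ij] := eqVneq i j.
  (* Coordinate [j] is overwritten by [v n], so its fixed value may be taken to be 0. *)
  subst i; rewrite (_ : (fun n => _) = fun n => At (dfwith (dfwith y j 0) j (v n))).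
    by apply: IHi; exact: vlexx.
  by apply/funext => n; rewrite dfwith_idem.
rewrite (_ : (fun n => _) = fun n => At (dfwith (dfwith y i (vpos (y i))) j (v n)) -
    At (dfwith (dfwith y i (vpos (- y i))) j (v n))).
  by rewrite -[X in _ --> X]subr0; apply: cvgB; exact/IHi/vpos_ge0.
apply/funext => n; rewrite !(dfwithC _ _ _ ij) -multilinearB ?vpos_sub; last exact: posAt.1.
by rewrite -dfwithC// dfwith_id.
Qed.

End genuine_bidual_extension.

Theorem proposition2p4 (R : realType) (m : nat)
    (E : 'I_m -> banachLatticeType R) (F : banachLatticeType R)
    (schurE : forall i, positive_schur (topdual (E i)))
    (ocF : order_continuous_norm F)
    (A : (forall i, E i) -> F) (posA : positive_multilinear A)
    (At : (forall i, topdual (topdual (E i))) -> topdual (topdual F))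
    (extA : bidual_extension A At)
    (posAt : positive_multilinear At)
    (genAt : genuine At)
    (wsAt : separately_weak_star_continuous At) :
  separately_almost_dunford_pettis At /\ separately_almost_dunford_pettis A.
Proof.
have At_cvgB j (x : forall i, topdual (topdual (E i))) p q :
    (forall n, 0 <=v p n) -> (forall n, 0 <=v q n) ->
    weakly_null p -> weakly_null q ->
    At (dfwith x j (p n - q n)) @[n --> \oo] --> 0.
  move=> p0 q0 pw qw.
  have cvg_pos := genuine_extension_cvg_pos schurE ocF posAt genAt wsAt.
  rewrite (_ : (fun n => _) =
      fun n => At (dfwith x j (p n)) - At (dfwith x j (q n))).
    by rewrite -[X in _ --> X]subr0; apply: cvgB; exact: cvg_pos.
  by apply/funext => n; exact: multilinearB posAt.1.
have [_ cAt AtJ] := extA.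
have cAtj j (x : forall i, topdual (topdual (E i))) :
    continuous (fun t => At (dfwith x j t)).
  move=> t; pose Dx t : prod_topology (fun i => topdual (topdual (E i))) := dfwith x j t.
  apply: (@cvg_comp _ _ _ Dx At _ (nbhs (Dx t))).
    exact: (@dfwith_continuous _ (fun i => topdual (topdual (E i))) x j).
  exact: cAt.
have parts (G : banachLatticeType R) (u : nat -> G) : disjoint_seq u -> weakly_null u ->
    weakly_null (fun n => vpos (u n)) /\ weakly_null (fun n => vpos (- u n)).
  move=> du u0; split; first exact: disjoint_weakly_null_pos.
  by apply: (disjoint_weakly_null_pos (disjoint_seqN du)); exact: weakly_nullN.
split=> j x; split.
- exact: posAt.1.
- exact: cAtj.
- move=> u du u0; have [pw qw] := parts _ _ du u0.
  under eq_fun do rewrite -(vpos_sub (u _)).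
  by apply: At_cvgB => // n; exact: vpos_ge0.
- exact: posA.1.
all: have AJ t : canonical_embedding (A (dfwith x j t)) =
    At (dfwith (fun i => canonical_embedding (x i)) j (canonical_embedding t))
  by rewrite -AtJ (dfwith_map (fun i => @canonical_embedding R (E i))).
- move=> t; apply/cvg_canonical_embedding; rewrite AJ.
  under eq_fun do rewrite AJ.
  apply: (@continuous_comp _ _ _ (@canonical_embedding R (E j))
    (fun t => At (dfwith _ j t))); last exact: cAtj.
  by apply/cvg_canonical_embedding.
- move=> u du u0; apply/cvg_canonical_embedding.
  have embedding0 : canonical_embedding (0 : F) = 0.
    by apply: topdual_ext => f; exact: (linear0 f).
  rewrite embedding0; have [pw qw] := parts _ _ du u0.
  (* The parts are taken in [E j], where [u] is disjoint, and then embedded; the embedding preserves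
     positivity and weak nullness. *)
  under eq_fun do rewrite AJ -(vpos_sub (u _)) canonical_embeddingB.
  apply: At_cvgB => [n|n||]; try exact/canonical_embedding_ge0/vpos_ge0.
    exact: weakly_null_canonical_embedding pw.
  exact: weakly_null_canonical_embedding qw.
Qed.
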